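(* Let $\mathcal{L}\subseteq\mathrm{Scat}$ be nonempty, downward $\preceq$-closed and ccs. Then the quasi-order $\trianglelefteq^{\mathcal{L}}_{\mathrm{LO}}$ does not have maximal elements, and every dominating family with respect to $\trianglelefteq^{\mathcal{L}}_{\mathrm{LO}}$ has size $2^{\aleph_0}$. Thus $\mathfrak{d}(\trianglelefteq^{\mathcal{L}}_{\mathrm{LO}})=2^{\aleph_0}$.
   Context: Linear orders are reflexive and nonempty. $L\preceq L'$ means there is an embedding $f:L\to L'$, i.e. $x\le_L y\iff f(x)\le_{L'}f(y)$. $\mathrm{LO}\subseteq 2^{\mathbb{N}\times\mathbb{N}}$ is the set of (codes for) linear orders with domain $\mathbb{N}$; $\mathrm{Fin}$ is the set of (codes for) nonempty linear orders on finite subsets of $\mathbb{N}$; $\mathrm{Lin}=\mathrm{Fin}\cup\mathrm{LO}$; $\mathrm{Scat}\subseteq\mathrm{Lin}$ is the set of scattered ones (those $L$ with $\mathbb{Q}\not\preceq L$). A class $\mathcal{L}\subseteq\mathrm{Lin}$ is downward $\preceq$-closed if $K\in\mathrm{Lin}$ and $K\preceq L\in\mathcal{L}$ imply $K\in\mathcal{L}$; membership in $\mathcal{L}$ is meant up to isomorphism. A subset $I$ of a linear order $L$ is convex if $x\le_L y\le_L z$ and $x,z\in I$ imply $y\in I$. For $A,B\subseteq L$ write $A\le_L B$ (resp. $A<_L B$) if $a\le_L b$ (resp. $a<_L b$) for all $a\in A$, $b\in B$. A $K$-convex partition of $L$ is a partition $(L_k)_{k\in K}$ of $L$ (into nonempty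 sets) such that $k<_K k'\iff L_k<_L L_{k'}$. The relation $L\trianglelefteq^{\mathcal{L}}L'$ holds iff there are $K\in\mathcal{L}$, a $K$-convex partition $(L_k)_{k\in K}$ of $L$, and an embedding $f$ of $L$ into $L'$ such that $f(L_k)$ is a convex subset of $L'$ for every $k\in K$. $\trianglelefteq^{\mathcal{L}}_{\mathrm{LO}}$ is its restriction to $\mathrm{LO}$. $\mathcal{L}$ is ccs (closed under convex sums) if for all $K,K'\in\mathcal{L}$ and every family $(K'_k)_{k\in K}$ of nonempty convex subsets of $K'$ such that $k_0<_K k_1\Rightarrow K'_{k_0}\le_{K'}K'_{k_1}$, we have $\sum_{k\in K}K'_k\in\mathcal{L}$, where $\sum_{k\in K}K'_k=\{(x,k): k\in K, x\in K'_k\}$ ordered antilexicographically. When $\mathcal{L}$ is ccs, $\trianglelefteq^{\mathcal{L}}$ is a quasi-order. For a quasi-order $\precsim$ on $X$: $x$ is maximal if there is no $y\in X$ with $x\precsim y$ and $y\not\precsim x$; $\mathcal{F}\subseteq X$ is a dominating family if for every $x\in X$ there is $y\in\mathcal{F}$ with $x\precsim y$; the dominating number $\mathfrak{d}(\precsim)$ is the least size of a dominating family. *)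

(* Defs.v *)
From mathcomp Require Import all_boot all_order all_algebra.
From mathcomp Require Import all_classical.

Set Implicit Arguments.
Unset Strict Implicit.
Unset Printing Implicit Defensive.

Local Open Scope classical_set_scope.
Local Open Scope card_scope.

(* An order on a subset of T is encoded by its (reflexive) relation r alone:
   the underlying set is recovered as the set of the x such that r x x.
   Elements of 2^(N x N) are the boolean relations [rel nat]. *)

Definition dom (T : Type) (r : rel T) : set T := [set x | r x x].

Definition lt_of (T : eqType) (r : rel T) : rel T :=
  fun x y => r x y && (x != y).

Definition linear_order (T : Type) (r : rel T) : Prop :=
  [/\ dom r !=set0,
      forall x y, r x y -> dom r x /\ dom r y,
      antisymmetric r,
      transitive r
    & forall x y, dom r x -> dom r y -> r x y || r y x].

(* The values of f outside [dom r] are irrelevant. *)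
Definition embedding (T U : Type) (r : rel T) (s : rel U) (f : T -> U) : Prop :=
  (forall x, dom r x -> dom s (f x)) /\
  (forall x y, dom r x -> dom r y -> r x y = s (f x) (f y)).

Definition embeds (T U : Type) (r : rel T) (s : rel U) : Prop :=
  exists f, embedding r s f.

Definition isomorphic (T U : Type) (r : rel T) (s : rel U) : Prop :=
  exists f, embedding r s f /\ f @` dom r = dom s.

Definition rat_order : rel rat := fun x y => (x <= y)%R.

Definition LO : set (rel nat) := [set r | linear_order r /\ dom r = setT].

Definition Fin : set (rel nat) := [set r | linear_order r /\ finite_set (dom r)].

Definition Lin : set (rel nat) := Fin `|` LO.

Definition Scat : set (rel nat) := [set r | Lin r /\ ~ embeds rat_order r].

Definition downward_closed (cL : set (rel nat)) : Prop :=
  forall K L, Lin K -> cL L -> embeds K L -> cL K.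

Definition convex_subset (T : Type) (r : rel T) (I : set T) : Prop :=
  I `<=` dom r /\ (forall x y z, I x -> I z -> r x y -> r y z -> I y).

Definition set_le (T : Type) (r : rel T) (A B : set T) : Prop :=
  forall a b, A a -> B b -> r a b.

Definition set_lt (T : eqType) (r : rel T) (A B : set T) : Prop :=
  set_le (lt_of r) A B.

(* [partition] includes the nonemptiness of the parts. *)
Definition convex_partition (K L : rel nat) (P : nat -> set nat) : Prop :=
  partition (dom K) P (dom L) /\
  (forall k k', dom K k -> dom K k' -> (lt_of K k k' <-> set_lt L (P k) (P k'))).

Definition pw_convex_embeds (cL : set (rel nat)) (L L' : rel nat) : Prop :=
  exists (K : rel nat) (P : nat -> set nat) (f : nat -> nat),
    [/\ cL K, convex_partition K L P, embedding L L' f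
      & forall k, dom K k -> convex_subset L' (f @` P k)].

(* Antilexicographic order on the pairs (x, k) with k in K and x in A k. *)
Definition convex_sum (K K' : rel nat) (A : nat -> set nat) : rel (nat * nat) :=
  fun p q =>
    [&& p.2 \in dom K, p.1 \in A p.2, q.2 \in dom K, q.1 \in A q.2
      & lt_of K p.2 q.2 || ((p.2 == q.2) && K' p.1 q.1)].

(* The sum lives on N x N, so its membership in cL is up to isomorphism. *)
Definition ccs (cL : set (rel nat)) : Prop :=
  forall (K K' : rel nat) (A : nat -> set nat),
    cL K -> cL K' ->
    (forall k, dom K k -> A k !=set0 /\ convex_subset K' (A k)) ->
    (forall k0 k1, lt_of K k0 k1 -> set_le K' (A k0) (A k1)) ->
    exists M, cL M /\ isomorphic M (convex_sum K K' A).

Definition maximal_element (T : Type) (X : set T) (R : T -> T -> Prop) (x : T) : Prop :=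
  X x /\ ~ (exists y, [/\ X y, R x y & ~ R y x]).

Definition dominating_family (T : Type) (X : set T) (R : T -> T -> Prop)
    (F : set T) : Prop :=
  F `<=` X /\ (forall x, X x -> exists y, F y /\ R x y).

(* The least size of a dominating family is the cardinality of C. *)
Definition dominating_number_is (T U : Type) (X : set T) (R : T -> T -> Prop)
    (C : set U) : Prop :=
  (exists F, dominating_family X R F /\ F #= C) /\
  (forall F, dominating_family X R F -> C #<= F).

Definition continuum : set (nat -> bool) := setT.

(* Main.v *)
Require Import Defs.
From mathcomp Require Import all_boot all_order all_algebra.
From mathcomp Require Import all_classical.
From mathcomp Require Import zify lra.

Local Open Scope classical_set_scope.
Local Open Scope card_scope.

Set Implicit Arguments.
Unset Strict Implicit.
Unset Printing Implicit Defensive.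
Import Order.TTheory GRing.Theory Num.Theory.

(** For x : nat -> bool, let [shuffle x] be the order obtained from Q by
    replacing each rational q by a finite block of 2c + x(c) + 1 points, where
    c = [color q] is a colouring of Q by natural numbers all of whose classes
    are dense ([color_dense]). Every interval of [shuffle x] then contains
    blocks of all the sizes 2n + x(n) + 1, and of no other size; hence x can be
    read off any convex copy of such an interval. More precisely, if L contains
    a convex copy of the blocks over an interval ]lo, hi[ of Q, and a is the
    last point of one of the blocks, then x(n) = 1 exactly when blocks of size
    2n + 2 occur in L arbitrarily close to a on its right. The latter condition
    involves L and a only, and defines a map [decode L a] that recovers x
    ([zone_decode]).

    Suppose now that M contains a convex copy of [shuffle x] and that M is
    piecewise convexly embedded in L, with pieces indexed by a scattered K. The
    map sending q to the index of the piece that contains the first point of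
    the block at q is monotone, and it is not an embedding of Q in K; so it
    takes the same value at some lo < hi. The blocks over ]lo, hi[ then lie in a
    single piece, so they have a convex copy in L, and x = [decode L a] for some
    a ([decode_pw_convex]). As there are only countably many points a, a given L
    lies above such orders M for countably many x only.

    Given L, the order L + [shuffle x], with x outside the range of [decode L],
    is therefore strictly above L: there is no maximal element. If F is
    dominating, then (L, a) |-> [decode L a] maps F x N onto 2^N, and a diagonal
    argument in (2^N)^N yields a surjection of F onto 2^N
    ([continuum_le_countable_to_one]); conversely there are at most 2^N binary
    relations on N. *)

(** * A colouring of the rationals with dense classes *)

(** The 2-adic valuation of the reduced denominator. *)
Definition color (q : rat) : nat := logn 2 `|denq q|.

Lemma color_odd_num (q : rat) (a : int) (n b : nat) :
  odd `|a| -> odd b -> (q * (2 ^ n * b)%:R = a%:~R)%R -> color q = n.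
Proof.
move=> odda oddb; have b0 : 0 < b by case: b oddb.
have a0 : 0 < `|a| by case: `|a|%N odda.
have d0 : 0 < `|denq q| by rewrite absz_gt0 denq_eq0.
move=> E.
have {E} : (numq q * Posz (2 ^ n * b) = a * denq q)%R.
  by apply: (@intr_inj rat); rewrite intrM [RHS]intrM -E numqE mulrAC.
move/(congr1 absz); rewrite !abszM => E.
have n0 : 0 < `|numq q|.
  case: posnP => // n0; have := muln_gt0 `|a| `|denq q|.
  by rewrite a0 d0 -E n0 mul0n.
have lodd k : odd k -> logn 2 k = 0.
  by move=> ok; rewrite lognE dvdn2 ok /= andbF.
move/(congr1 (logn 2)): E.
rewrite !lognM ?muln_gt0 ?expn_gt0 ?b0 ?n0 // lognX (lodd _ odda) (lodd _ oddb).
rewrite (_ : logn 2 2 = 1) // muln1 addn0 add0n -/(color q).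
have := coprime_num_den q; rewrite /coprime => /eqP cop E.
case: (posnP (logn 2 `|numq q|)) => [z|pos]; first by rewrite -E z.
have dn : 2 %| `|numq q| by move: pos; rewrite logn_gt0 mem_primes => /and3P[].
have: 0 < logn 2 `|denq q| by rewrite -/(color q) -E; lia.
rewrite logn_gt0 mem_primes => /and3P[_ _ dd].
by have := dvdn_gcd 2 `|numq q| `|denq q|; rewrite dn dd cop.
Qed.

(** If b is odd, the fractions a / (2^n * b) with a odd all have color n; they
    are 2 / (2^n * b) apart, which is small when b is large. *)
Lemma color_dense (p q : rat) (n : nat) :
  (p < q)%R -> exists2 u : rat, (p < u < q)%R & color u = n.
Proof.
move=> pq.
pose M := Num.bound (2 / (q - p))%R.
pose b := M.*2.+1; pose d : rat := (2 ^ n * b)%:R%R.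
have MP : (2 / (q - p) < M%:R :> rat)%R.
  by apply: archi_boundP; rewrite divr_ge0 // subr_ge0 ltW.
have Md : (M%:R <= d)%R.
  rewrite ler_nat /b; have := expn_gt0 2 n; nia.
have d0 : (0 < d)%R by rewrite ltr0n muln_gt0 expn_gt0.
have qpd : (2 < (q - p) * d)%R.
  by rewrite mulrC -ltr_pdivrMr ?subr_gt0 //; exact: lt_le_trans MP Md.
pose k := Num.floor ((p * d - 1) / 2)%R.
pose a : int := (2 * (k + 1) + 1)%R.
have /andP[kle klt] := floor_itv ((p * d - 1) / 2)%R.
rewrite -/k in kle klt.
have aE : (a%:~R = 2 * (k + 1)%:~R + 1 :> rat)%R by rewrite /a rmorphD rmorphM.
have kE : ((k + 1)%:~R = k%:~R + 1 :> rat)%R by rewrite rmorphD.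
exists (a%:~R / d)%R.
  rewrite ltr_pdivlMr // ltr_pdivrMr //; apply/andP; split.
    by rewrite aE; lra.
  rewrite aE; have : ((q - p) * d = q * d - p * d)%R by rewrite mulrBl.
  lra.
apply: (@color_odd_num _ a n b).
- by rewrite /a; lia.
- by rewrite /b /= odd_double.
- by rewrite -/d divfK // gt_eqF.
Qed.

(** * Shuffles of finite blocks *)

(** The pair (q, i) is the point number i of the block at q; pairs are ordered
    by q first, then by i. *)
Notation point := (rat *l nat)%type.

(** The number of the last point of the block at q: as points are numbered from
    0, the block has one more point. *)
Definition block_top (x : nat -> bool) (q : rat) : nat :=
  (color q).*2 + x (color q).

Definition in_shuffle (x : nat -> bool) : pred point :=
  fun w => w.2 <= block_top x w.1.

(** The Q-sum of the blocks coding x, as an order on the set of the pairs (q, i)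
    with i <= [block_top x q]. *)
Definition shuffle (x : nat -> bool) : rel point :=
  fun v w => [&& in_shuffle x v, in_shuffle x w & (v <= w)%O].

Lemma point_ltE (v w : point) :
  (v < w)%O = (v.1 < w.1)%R || ((v.1 == w.1) && (v.2 < w.2)).
Proof. by rewrite ltEprodlexi /=; case: (ltgtP v.1 w.1). Qed.

Lemma shuffle_linear x : linear_order (shuffle x).
Proof.
split.
- by exists (0%R, 0%N); rewrite /dom /= /shuffle /in_shuffle lexx.
- by move=> v w /and3P[dv dw _]; rewrite /dom /= /shuffle dv dw !lexx.
- by move=> v w /andP[/and3P[_ _ vw] /and3P[_ _ wv]]; apply/le_anti; rewrite vw wv.
- move=> w v u /and3P[dv _ vw] /and3P[_ du wu].
  by rewrite /shuffle dv du (le_trans vw wu).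
- move=> v w /and3P[dv _ _] /and3P[dw _ _].
  by rewrite /shuffle dv dw; exact: le_total.
Qed.

(** * Reading a binary sequence off an order *)

(** b is the immediate successor of a. *)
Definition covers (T : eqType) (r : rel T) (a b : T) : Prop :=
  lt_of r a b /\ forall c, ~ (lt_of r a c /\ lt_of r c b).

(** Exactly m points can be reached from a by taking immediate successors. *)
Fixpoint chain (T : eqType) (r : rel T) (m : nat) (a : T) : Prop :=
  if m is m'.+1 then exists2 b, covers r a b & chain r m' b
  else ~ exists b, covers r a b.

(** a is the first point of a maximal run of m.+1 consecutive points. *)
Definition block_start (T : eqType) (r : rel T) (m : nat) (a : T) : Prop :=
  (~ exists b, covers r b a) /\ chain r m a.

(** The set of the n such that runs of 2n + 2 points start arbitrarily close to
    a on its right. *)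
Definition decode (T : eqType) (r : rel T) (a : T) : nat -> bool :=
  fun n => `[< forall d, lt_of r a d ->
    exists b, [/\ lt_of r a b, lt_of r b d & block_start r n.*2.+1 b] >].

Section LOFacts.
Variables (r : rel nat) (rLO : LO r).

Lemma LO_refl a : r a a.
Proof. by case: rLO => _ dr; have : [set: nat] a by []; rewrite -dr. Qed.

Lemma LO_trans : transitive r.
Proof. by case: rLO => -[]. Qed.

Lemma LO_anti a b : r a b -> r b a -> a = b.
Proof. by case: rLO => -[_ _ anti _ _] _ ab ba; apply: anti; rewrite ab. Qed.

Lemma LO_total a b : r a b || r b a.
Proof. by case: rLO => -[_ _ _ _ tot] _; apply: tot; exact: LO_refl. Qed.

Lemma LO_ltNge a b : lt_of r a b = ~~ r b a.
Proof.
rewrite /lt_of; have := LO_total a b.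
case: eqVneq => [->|ne]; first by rewrite LO_refl.
case ab: (r a b); case ba: (r b a) => //= _.
by rewrite (LO_anti ab ba) eqxx in ne.
Qed.

End LOFacts.

(** * Convex copies of an interval of blocks *)

(** Here g embeds the blocks of [shuffle x] over the interval ]lo, hi[, which
    form the [zone], onto a convex subset of r. As ]lo, hi[ has no endpoints,
    the immediate successors and predecessors in r of a point of the copy stay
    in the copy, and in the same block. *)
Section Zone.
Variables (r : rel nat) (x : nat -> bool) (lo hi : rat) (g : point -> nat).
Hypothesis rLO : LO r.

Let zone (w : point) := in_shuffle x w && (lo < w.1 < hi)%R.

Hypothesis gle : forall v w, zone v -> zone w -> r (g v) (g w) = (v <= w)%O.
Hypothesis gconvex : forall v w b, zone v -> zone w ->
  r (g v) b -> r b (g w) -> exists2 u, zone u & b = g u.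

Let glt v w : zone v -> zone w -> lt_of r (g v) (g w) = (v < w)%O.
Proof. by move=> zv zw; rewrite LO_ltNge // gle // ltNge. Qed.

Let ginj v w : zone v -> zone w -> g v = g w -> v = w.
Proof.
by move=> zv zw E; apply/le_anti; rewrite -!gle // E LO_refl.
Qed.

Let zoneE u i : zone (u, i) = (i <= block_top x u) && (lo < u < hi)%R.
Proof. by []. Qed.

Lemma zone_covers v b : zone v -> covers r (g v) b ->
  v.2 < block_top x v.1 /\ b = g (v.1, v.2.+1).
Proof.
move=> zv [vb nob]; have /andP[vin /andP[lov vhi]] := zv.
have [u /andP[vu uhi] _] := color_dense 0 vhi.
have zu : zone (u, 0) by rewrite zoneE uhi (lt_trans lov vu).
have vltu : lt_of r (g v) (g (u, 0)) by rewrite glt // point_ltE vu.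
have rvb : r (g v) b by case/andP: vb.
have rbu : r b (g (u, 0)).
  by apply/negPn/negP; rewrite -LO_ltNge // => ub; apply: (nob (g (u, 0))).
have [w zw bE] := gconvex zv zu rvb rbu; subst b.
move: vb; rewrite glt // point_ltE => /orP[vw1|/andP[/eqP vw1 vw2]].
  have [t /andP[vt tw] _] := color_dense 0 vw1.
  have zt : zone (t, 0).
    rewrite zoneE (lt_trans lov vt) /=.
    by case/andP: zw => _ /andP[_ whi]; exact: lt_trans tw whi.
  by case: (nob (g (t, 0))); rewrite !glt // !point_ltE vt tw.
have wtop : w.2 <= block_top x w.1 by case/andP: zw.
have ltop : v.2 < block_top x v.1 by rewrite vw1; exact: leq_trans vw2 wtop.
split=> //; congr g; rewrite [w]surjective_pairing -vw1; congr pair.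
apply/eqP; rewrite eqn_leq vw2 andbT leqNgt; apply/negP => far.
have zS : zone (v.1, v.2.+1) by rewrite zoneE ltop lov vhi.
case: (nob (g (v.1, v.2.+1))).
by rewrite !glt // !point_ltE /= vw1 eqxx ltnSn far !orbT.
Qed.

Lemma zone_coversS v : zone v -> v.2 < block_top x v.1 ->
  zone (v.1, v.2.+1) /\ covers r (g v) (g (v.1, v.2.+1)).
Proof.
move=> zv ltop; have /andP[vin lvh] := zv.
have zS : zone (v.1, v.2.+1) by rewrite zoneE ltop.
split=> //; split; first by rewrite glt // point_ltE eqxx ltnSn orbT.
move=> c [vc cS].
have [||u zu cE] := gconvex zv zS (b := c);
  [by case/andP: vc|by case/andP: cS|].
move: vc cS; rewrite cE !glt // !point_ltE /=.
by case: (ltgtP v.1 u.1) => //= _ vu uv; lia.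
Qed.

Lemma zone_chain m v : zone v -> chain r m (g v) <-> v.2 + m = block_top x v.1.
Proof.
elim: m v => [|m IHm] v zv /=.
  have vtop : v.2 <= block_top x v.1 by case/andP: zv.
  rewrite addn0; split=> [nocov|vE [b /(zone_covers zv)[]]];
    last by rewrite vE ltnn.
  apply/eqP; rewrite eqn_leq vtop leqNgt; apply/negP => ltop; apply: nocov.
  by exists (g (v.1, v.2.+1)); case: (zone_coversS zv ltop).
split=> [[b cov]|vE].
  have [ltop ->] := zone_covers zv cov; have [zS _] := zone_coversS zv ltop.
  by rewrite IHm //= addSnnS.
have ltop : v.2 < block_top x v.1 by rewrite -vE addnS ltnS leq_addr.
have [zS cov] := zone_coversS zv ltop.
by exists (g (v.1, v.2.+1)) => //; rewrite IHm //= addSnnS.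
Qed.

Lemma zone_block_start m v :
  zone v -> block_start r m (g v) <-> v.2 = 0 /\ m = block_top x v.1.
Proof.
move=> zv; have /andP[vin /andP[lov vhi]] := zv; rewrite /block_start zone_chain //.
split=> [[nocov]|[v0]].
  suff -> : v.2 = 0 by rewrite add0n.
  case E: v.2 => [//|k]; case: nocov.
  have kin : k < block_top x v.1 by rewrite -E; exact: vin.
  have zk : zone (v.1, k) by rewrite zoneE (ltnW kin) lov.
  exists (g (v.1, k)); have [_] := zone_coversS zk kin.
  by rewrite /= -E -surjective_pairing.
rewrite v0 add0n; split=> // -[a [av noa]].
have [u /andP[lou uv] _] := color_dense 0 lov.
have zu : zone (u, 0) by rewrite zoneE lou (lt_trans uv vhi).
have rua : r (g (u, 0)) a.
  apply/negPn/negP; rewrite -LO_ltNge // => au; apply: (noa (g (u, 0))).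
  by rewrite glt // point_ltE uv.
have [|w zw aE] := gconvex zu zv rua; first by case/andP: av.
have [ltop] : w.2 < block_top x w.1 /\ g v = g (w.1, w.2.+1).
  by apply: zone_covers => //; rewrite -aE.
by have [zS _] := zone_coversS zw ltop; move=> /(ginj zv zS) vE; rewrite vE in v0.
Qed.

Lemma zone_decode t : (lo < t < hi)%R -> decode r (g (t, block_top x t)) = x.
Proof.
move=> /andP[lot thi]; set a := (t, block_top x t).
have za : zone a by rewrite zoneE leqnn lot.
apply/funext => n; apply/asboolP/idP => [close|xn d ad].
  have [s /andP[ts shi] _] := color_dense 0 thi.
  have zs : zone (s, 0) by rewrite zoneE shi (lt_trans lot ts).
  have [|b [ab bs]] := close (g (s, 0)); first by rewrite glt // point_ltE /= ts.
  have [||w zw ->] := gconvex za zs (b := b);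
    [by case/andP: ab|by case/andP: bs|].
  move=> /(zone_block_start _ zw)[_]; rewrite /block_top.
  move: (color w.1) => c.
  (* By parity, 2n + 1 = 2c + x(c) forces x(c) = 1 and n = c. *)
  by case xc: (x c) => /= E; [have -> : n = c by lia|lia].
(* Some s beyond t is such that the blocks over ]t, s[ start before d:
   either d lies beyond a block, or it lies in one by convexity. *)
have [s ts sd] : exists2 s, (t < s < hi)%R &
    forall u, (t < u < s)%R -> lt_of r (g (u, 0)) d.
  have [s /andP[ts shi] _] := color_dense 0 thi.
  have zs : zone (s, 0) by rewrite zoneE shi (lt_trans lot ts).
  case sd: (r (g (s, 0)) d).
    exists s; first by rewrite ts.
    move=> u /andP[tu us]; rewrite LO_ltNge //; apply/negP => du.
    have zu : zone (u, 0) by rewrite zoneE (lt_trans lot tu) (lt_trans us shi).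
    have := LO_trans rLO sd du; rewrite gle // leNgt point_ltE us //.
  have [||w zw dE] := gconvex za zs (b := d); [by case/andP: ad| |].
    by have := LO_total rLO d (g (s, 0)); rewrite sd orbF.
  have /andP[win /andP[low whi]] := zw.
  have tw : (t < w.1)%R.
    move: ad; rewrite dE glt // point_ltE => /orP[//|/andP[/eqP /= tE]].
    by move: win; rewrite /in_shuffle -tE => wle; rewrite ltnNge wle.
  exists w.1; first by rewrite tw.
  move=> u /andP[tu uw]; rewrite dE glt // ?point_ltE ?uw //.
  by rewrite zoneE (lt_trans lot tu) (lt_trans uw whi).
have /andP[lts shi] := ts.
have [u /andP[tu us] cu] := color_dense n lts.
have zu : zone (u, 0) by rewrite zoneE (lt_trans lot tu) (lt_trans us shi).
exists (g (u, 0)); split.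
- by rewrite glt // point_ltE /= tu.
- by apply: sd; rewrite tu.
- by apply/zone_block_start => //; rewrite /block_top /= cu xn addn1.
Qed.

End Zone.

(** * Piecewise convex embeddings of shuffles *)

Lemma partition_index_le (K L : rel nat) P k k' a b :
  linear_order K -> LO L -> convex_partition K L P -> dom K k -> dom K k' ->
  P k a -> P k' b -> L a b -> K k k'.
Proof.
move=> [_ _ _ _ tot] LLO [_ Plt] dk dk' Pa Pb ab.
have /orP[//|k'k] := tot _ _ dk dk'.
have [-> //|ne] := eqVneq k k'; suff : ~~ L a b by rewrite ab.
rewrite -LO_ltNge //; apply: (iffLR (Plt k' k dk' dk)) => //.
by rewrite /lt_of k'k eq_sym.
Qed.

Lemma decode_pw_convex cL (scatL : cL `<=` Scat) (M L : rel nat) x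
    (j : point -> nat) :
  LO M -> LO L -> embedding (shuffle x) M j ->
  convex_subset M (j @` dom (shuffle x)) ->
  pw_convex_embeds cL M L -> exists a, decode L a = x.
Proof.
move=> MLO LLO [_ jle] [_ jconv] [K [P [f [KcL part [_ fle] fconv]]]].
have dM a : dom M a by exact: LO_refl.
have dsh w : in_shuffle x w -> dom (shuffle x) w.
  by move=> dw; rewrite /dom /= /shuffle dw lexx.
have in0 u : in_shuffle x (u, 0) by [].
have {}jle v w : in_shuffle x v -> in_shuffle x w -> M (j v) (j w) = (v <= w)%O.
  by move=> dv dw; rewrite -jle ?/shuffle ?dv ?dw //; exact: dsh.
have [KLin noQ] := scatL _ KcL.
have Klin : linear_order K by case: KLin => -[].
have [[Pcov _ _] _] := part.
have piece a : exists k, dom K k /\ P k a.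
  by have := dM a; rewrite -Pcov => -[k dk Pk]; exists k.
pose kappa (u : rat) := projT1 (cid (piece (j (u, 0)))).
have [kdom kP] : (forall u, dom K (kappa u)) /\ forall u, P (kappa u) (j (u, 0)).
  by split=> u; rewrite /kappa; case: cid => k [].
have kmono u v : (u <= v)%R -> K (kappa u) (kappa v).
  move=> uv; apply: (partition_index_le Klin MLO part _ _ (kP u) (kP v)) => //.
  by rewrite jle // leEprodlexi /= uv lexx implybT.
(* Otherwise the monotone map kappa would embed Q in the scattered order K. *)
have [lo [hi [lohi kE]]] : exists lo hi, (lo < hi)%R /\ kappa lo = kappa hi.
  apply: contrapT => kinj; apply: noQ; exists kappa.
  split=> [u _|u v _ _]; first exact: kdom.
  apply/idP/idP => [|kuv]; first exact: kmono.
  rewrite /rat_order leNgt; apply/negP => vu; apply: kinj; exists v, u; split=> //.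
  by case: Klin => _ _ anti _ _; apply: anti; rewrite kuv (kmono _ _ (ltW vu)).
have [t ltht _] := color_dense 0 lohi.
exists (f (j (t, block_top x t))).
have in_piece w : in_shuffle x w -> (lo < w.1 < hi)%R -> P (kappa lo) (j w).
  move=> dw /andP[low whi]; have [k [dk Pk]] := piece (j w).
  suff -> : kappa lo = k by [].
  case: (Klin) => _ _ anti _ _; apply: anti; apply/andP; split.
    apply: (partition_index_le Klin MLO part _ _ (kP lo) Pk) => //.
    by rewrite jle // ltW // point_ltE low.
  rewrite kE; apply: (partition_index_le Klin MLO part _ _ Pk (kP hi)) => //.
  by rewrite jle // ltW // point_ltE whi.
apply: (@zone_decode L x lo hi (f \o j)) => //.
  by move=> v w /andP[dv _] /andP[dw _]; rewrite /= -fle // jle.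
move=> v w b /andP[dv lvh] /andP[dw lwh] vb bw.
have [_ fc] := fconv _ (kdom lo).
have [y Py yE] : (f @` P (kappa lo)) b.
  by apply: fc vb bw; [exists (j v)|exists (j w)] => //; exact: in_piece.
move: vb bw; rewrite -yE /= -!fle // => vy yw.
have [u du uE] : (j @` dom (shuffle x)) y.
  by apply: jconv vy yw; [exists v|exists w] => //; exact: dsh.
have {}du : in_shuffle x u by case/andP: du.
exists u; last by rewrite -uE.
rewrite du /=; move: vy yw.
rewrite -uE !jle // !leEprodlexi => /andP[vu _] /andP[uw _].
case/andP: lvh => lov _; case/andP: lwh => _ whi.
by rewrite (lt_le_trans lov vu) (le_lt_trans uw whi).
Qed.

(** * Orders on the natural numbers *)

(** The injection h ensures that the order is infinite. *)
Lemma LO_code (T : countType) (r : rel T) (h : nat -> T) :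
  linear_order r -> injective h -> (forall n, dom r (h n)) ->
  exists M, exists2 e : T -> nat, LO M & embedding r M e /\ e @` dom r = setT.
Proof.
move=> [ne rdom anti tr tot] hinj hdom.
have : dom r #= [set: nat].
  apply/card_eqPle; split.
    by apply/pcard_injP; exists pickle => a b _ _; exact: (pcan_inj pickleK).
  have /card_eqPle[_ natle] := @inj_card_eq _ _ [set: nat] h (in2W hinj).
  by apply: card_le_trans natle _; apply: subset_card_le => _ [n _ <-].
case/card_set_bijP => e [_ einj esurj].
have [d dP] : {d : nat -> T & forall n, dom r (d n) /\ e (d n) = n}.
  apply: (choice (P := fun n t => dom r t /\ e t = n)) => n.
  by have [t dt <-] := esurj n I; exists t.
have dinj m n : d m = d n -> m = n by move=> E; rewrite -(dP m).2 E (dP n).2.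
have ed t : dom r t -> d (e t) = t.
  move=> dt; apply: einj; rewrite ?inE //; [exact: (dP _).1|exact: (dP _).2].
exists (fun m n => r (d m) (d n)), e.
  split; last by apply/seteqP; split=> // n _; exact: (dP n).1.
  split.
  - by exists 0; exact: (dP 0).1.
  - by move=> m n _; split; exact: (dP _).1.
  - by move=> m n /anti/dinj.
  - by move=> m n k; exact: tr.
  - by move=> m n _ _; apply: tot; exact: (dP _).1.
split; first split.
- by move=> t dt; rewrite /dom /= ed.
- by move=> s t ds dt; rewrite !ed.
- by apply/seteqP; split=> // n _; have [dn en] := dP n; exists (d n).
Qed.

(** The sum r + s: the points of r come first. *)
Definition ord_sum (T U : Type) (r : rel T) (s : rel U) : rel (T + U) :=
  fun p q => match p, q with
  | inl a, inl b => r a b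
  | inl a, inr b => r a a && s b b
  | inr _, inl _ => false
  | inr a, inr b => s a b
  end.

Lemma ord_sum_linear (T U : Type) (r : rel T) (s : rel U) :
  linear_order r -> linear_order s -> linear_order (ord_sum r s).
Proof.
move=> [[a0 da0] rdom ranti rtr rtot] [_ sdom santi strans stot]; split.
- by exists (inl a0).
- move=> [a|a] [b|b] //=; [exact: rdom| |exact: sdom].
  by case/andP.
- by move=> [a|a] [b|b] //=; [move/ranti->|rewrite andbF|move/santi->].
- move=> [b|b] [a|a] [c|c] //=; [exact: rtr| | |exact: strans].
  + by move=> /rdom[-> _] /andP[_ ->].
  + by move=> /andP[-> _] /sdom[_ ->].
- move=> [a|a] [b|b] da db; [exact: rtot| | |exact: stot].
  + by rewrite /ord_sum [r a a]da [s b b]db.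
  + by rewrite /ord_sum [s a a]da [r b b]db.
Qed.

(** M is a copy on N of L + [shuffle x]. *)
Lemma sum_shuffle L x : LO L -> exists M, [/\ LO M,
  exists2 i, embedding L M i & convex_subset M (i @` dom L)
  & exists2 j, embedding (shuffle x) M j
    & convex_subset M (j @` dom (shuffle x))].
Proof.
move=> LLO; pose r := ord_sum L (shuffle x).
have rlin : linear_order r by apply: ord_sum_linear (shuffle_linear x); case: LLO.
have [|n|M [e MLO [[_ ele] eT]]] := LO_code (h := inl) rlin.
- by move=> m n [].
- exact: LO_refl.
have [_ rdom _ _ _] := rlin.
exists M; split=> //.
- exists (e \o inl).
    by split=> [a _|a b da db]; [exact: LO_refl|rewrite /= -ele].
  split=> [a _|_ b _ [a da <-] [c dc <-] ab bc]; first exact: LO_refl.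
  have : [set: nat] b by []; rewrite -eT => -[[b'|b'] db bE]; first by exists b'.
  by move: bc; rewrite -bE -ele.
- exists (e \o inr).
    by split=> [a _|a b da db]; [exact: LO_refl|rewrite /= -ele].
  split=> [a _|_ b _ [a da <-] [c dc <-] ab bc]; first exact: LO_refl.
  have : [set: nat] b by []; rewrite -eT => -[[b'|b'] db bE]; last by exists b'.
  by move: ab; rewrite -bE -ele.
Qed.

(** The one-point order belongs to every nonempty downward closed class, so that
    one piece is always allowed. *)
Lemma convex_embeds_pw cL (L M : rel nat) f :
  cL !=set0 -> downward_closed cL -> cL `<=` Lin -> LO L ->
  embedding L M f -> convex_subset M (f @` dom L) -> pw_convex_embeds cL L M.
Proof.
move=> [K0 cK0] downL linL LLO fe fc.
have dL : dom L = setT by case: LLO.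
pose one : rel nat := fun a b => (a == 0) && (b == 0).
have d1 a : dom one a -> a = 0 by case/andP => /eqP.
exists one, (fun=> setT), f; split=> //; last by rewrite -dL.
  have [a0 da0] : dom K0 !=set0 by case: (linL _ cK0) => -[[]].
  apply: downL cK0 _.
    left; split; last by apply: (sub_finite_set _ (finite_set1 0)) => a /d1 ->.
    split.
    - by exists 0.
    - by move=> a b /andP[/eqP-> /eqP->].
    - by move=> a b /andP[/andP[/eqP-> /eqP->]].
    - by move=> b a c /andP[/eqP-> _] /andP[_ /eqP->].
    - by move=> a b /d1-> /d1->.
  by exists (fun=> a0); split=> [//|a b /d1-> /d1->]; rewrite [K0 _ _]da0.
split.
  split.
  - by rewrite dL; apply/seteqP; split=> // a _; exists 0.
  - by move=> a b /d1-> /d1->.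
  - by move=> a _; exists 0.
move=> a b /d1-> /d1->; split=> [/andP[]//|/(_ 0 0 I I)].
by rewrite /lt_of eqxx andbF.
Qed.

(** * Cardinality *)

Lemma card_rel_nat_continuum : [set: rel nat] #<= continuum.
Proof.
apply/pcard_injP.
exists (fun r n => if unpickle n is Some (a, b) then r a b else false).
move=> r s _ _ E; apply/funext => a; apply/funext => b.
by have := congr1 (@^~ (pickle (a, b))) E; rewrite pickleK.
Qed.

(** If F x N maps onto 2^N, then so does F. Otherwise, for each a, the map
    sending r to the a-th column of h r a misses some column z a; then the
    sequence with columns z a is not of the form h r a. *)
Lemma continuum_le_countable_to_one (T : Type) (F : set T)
    (h : T -> nat -> nat -> bool) :
  (forall x, exists2 r, F r & exists a, h r a = x) -> continuum #<= F.
Proof.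
move=> cover; apply/pcard_surjP.
have [a surj] : exists a, forall y : nat -> bool,
    exists2 r, F r & (fun m => h r a (pickle (a, m))) = y.
  apply: contrapT => /forallNP missed.
  have [z zP] : {z : nat -> nat -> bool & forall a,
      ~ exists2 r, F r & (fun m => h r a (pickle (a, m))) = z a}.
    pose P a (y : nat -> bool) :=
      ~ exists2 r, F r & (fun m => h r a (pickle (a, m))) = y.
    by apply: (choice (P := P)) => a; apply/existsNP => /missed.
  have [r Fr [a E]] := cover (fun n =>
    if unpickle n is Some (a, m) then z a m else false).
  by apply: (zP a); exists r => //; rewrite E; apply/funext => m; rewrite pickleK.
exists (fun r m => h r a (pickle (a, m))) => y _.
by have [r Fr <-] := surj y; exists r.
Qed.

Theorem theorem5p3 (cL : set (rel nat)) (scatL : cL `<=` Scat)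
    (nonemptyL : cL !=set0) (downL : downward_closed cL) (ccsL : ccs cL) :
  [/\ ~ (exists L : rel nat, maximal_element LO (pw_convex_embeds cL) L),
      forall F : set (rel nat),
        dominating_family LO (pw_convex_embeds cL) F -> F #= continuum
    & dominating_number_is LO (pw_convex_embeds cL) continuum].
Proof.
have linL : cL `<=` Lin by move=> K /scatL[].
have sizeF F : dominating_family LO (pw_convex_embeds cL) F -> F #= continuum.
  move=> [FLO Fdom]; apply/card_eqPle; split.
    by apply: card_le_trans card_rel_nat_continuum; exact: subset_card_le.
  apply: (@continuum_le_countable_to_one _ F (@decode nat)) => x.
  (* Any order on N would do as the first summand. *)
  have natLO : LO (fun m n : nat => m <= n).
    split; last by apply/seteqP; split=> // n _; exact: leqnn.
    split=> //; [by exists 0|by move=> m n; rewrite /dom /= !leqnn|exact: anti_leq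
                |exact: leq_trans|by move=> m n _ _; exact: leq_total].
  have [M [MLO _ [j je jc]]] := sum_shuffle x natLO.
  have [L [FL ML]] := Fdom _ MLO.
  by exists L => //; exact: (decode_pw_convex scatL MLO (FLO _ FL) je jc ML).
split=> //.
- move=> [L [LLO Lmax]]; apply: Lmax.
  have [M [MLO [i ie ic] [j je jc]]] := sum_shuffle (fun n => ~~ decode L n n) LLO.
  exists M; split=> //; first exact: convex_embeds_pw ie ic.
  move=> ML; have [a E] := decode_pw_convex scatL MLO LLO je jc ML.
  by have := congr1 (@^~ a) E; case: (decode L a a).
- have LOdom : dominating_family LO (pw_convex_embeds cL) LO.
    split=> // L LLO; exists L; split=> //.
    have dL : dom L = setT by case: LLO.
    apply: (@convex_embeds_pw _ _ _ id) => //.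
    by split=> [a _|//]; rewrite dL.
  split; first by exists LO; split=> //; exact: sizeF.
  by move=> F /sizeF; rewrite card_eq_sym; case/card_eqPle.
Qed.
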